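(* For $n\ge 1$ and $i\ge 0$, let $\mathcal{C}_{(\geq,\geq)}(n,i)$ denote the set of Catalan words $w=w_1\cdots w_n$ of length $n$ that avoid the pattern $(\geq,\geq)$ and whose last letter is $w_n=i$. Define \[ C_i^{\geq}(x;p,q)=\sum_{n\geq 1}x^n \sum_{w\in \mathcal{C}_{(\geq, \geq)}(n,i)}p^{\mathrm{sper}(w)}q^{\mathrm{area}(w)},\qquad C^{\geq}(x;p,q;v)=\sum_{i \geq 0}C_i^{\geq}(x;p,q)v^{i}. \] Then $C^{\geq}(x;p,q;v)$ satisfies the functional equation \[ C^{\geq}(x;p,q;v)=p^2qx+p^3q^2x^2+\frac{p^3q^3x^2}{1-qv}C^{\geq}(x;p,q;q)+p^2 q^2xv\,C^{\geq}(x;p,q;qv)-\frac{p^3q^5 x^2v^2}{1-qv}C^{\geq}(x;p,q;q^2v). \]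
   Context: A Catalan word of length $n\ge 0$ is a sequence $w=w_1\cdots w_n$ of non-negative integers with $w_1=0$ and $0\le w_i\le w_{i-1}+1$ for $i=2,\dots,n$. It avoids the pattern $(\geq,\geq)$ if there is no index $i$ with $w_i\ge w_{i+1}\ge w_{i+2}$. To $w$ is associated the polyomino (bargraph) $P(w)$ with $n$ bottom-aligned columns, the $i$-th column consisting of $w_i+1$ unit cells. $\mathrm{area}(w)$ is the number of cells of $P(w)$, i.e. $\sum_{i=1}^n (w_i+1)$; $\mathrm{sper}(w)$ (the semiperimeter) is half the perimeter of $P(w)$, the perimeter being the number of cell edges of $P(w)$ not shared with another cell of $P(w)$. *)

(* Defs.v *)
From HB Require Import structures.
From mathcomp Require Import all_boot all_order all_algebra.
From mathcomp Require Import boolp classical_sets fsbigop zify.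

Set Implicit Arguments.
Unset Strict Implicit.
Unset Printing Implicit Defensive.

Import GRing.Theory.
Local Open Scope ring_scope.

Record fps (R : Type) := FPS { fps_coef : nat -> R }.

HB.instance Definition _ (R : Type) := gen_eqMixin (fps R).
HB.instance Definition _ (R : Type) := gen_choiceMixin (fps R).

Lemma fpsP (R : Type) (f g : fps R) :
  (forall n, fps_coef f n = fps_coef g n) <-> f = g.
Proof.
split=> [|-> //]; case: f g => [f] [g] /= fg.
by congr FPS; apply: functional_extensionality_dep.
Qed.

Section FpsRing.
Variable R : comNzRingType.
Implicit Types f g h : fps R.

Definition fps_zero : fps R := FPS (fun=> 0).
Definition fps_opp f : fps R := FPS (fun n => - fps_coef f n).
Definition fps_add f g : fps R := FPS (fun n => fps_coef f n + fps_coef g n).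
Definition fpsC (c : R) : fps R := FPS (fun n => if n == 0%N then c else 0).
Definition fpsX : fps R := FPS (fun n => (n == 1%N)%:R).
Definition fps_mul f g : fps R :=
  FPS (fun n => \sum_(i < n.+1) fps_coef f i * fps_coef g (n - i)).

Fact fps_addA : associative fps_add.
Proof. by move=> f g h; apply/fpsP => n /=; rewrite addrA. Qed.
Fact fps_addC : commutative fps_add.
Proof. by move=> f g; apply/fpsP => n /=; rewrite addrC. Qed.
Fact fps_add0 : left_id fps_zero fps_add.
Proof. by move=> f; apply/fpsP => n /=; rewrite add0r. Qed.
Fact fps_addN : left_inverse fps_zero fps_opp fps_add.
Proof. by move=> f; apply/fpsP => n /=; rewrite addNr. Qed.

HB.instance Definition _ :=
  GRing.isZmodule.Build (fps R) fps_addA fps_addC fps_add0 fps_addN.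

Let trunc m f : {poly R} := \poly_(i < m) fps_coef f i.

Let fps_mul_trunc m n f g : (n < m)%N ->
  fps_coef (fps_mul f g) n = (trunc m f * trunc m g)`_n.
Proof.
move=> nm; rewrite coefM; apply: eq_bigr => i _.
have im : (i < m)%N by apply: leq_ltn_trans nm; rewrite -ltnS.
have nim : (n - i < m)%N by apply: leq_ltn_trans nm; apply: leq_subr.
by rewrite !coef_poly im nim.
Qed.

Fact fps_mulC : commutative fps_mul.
Proof.
by move=> f g; apply/fpsP => n; rewrite !(@fps_mul_trunc n.+1) // mulrC.
Qed.

Fact fps_mulA : associative fps_mul.
Proof.
move=> f g h; apply/fpsP => n.
have truncM a b c (m := n.+1) :
    fps_coef (fps_mul (fps_mul a b) c) n = (trunc m a * trunc m b * trunc m c)`_n.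
  rewrite (fps_mul_trunc _ _ (ltnSn n)) !coefM; apply: eq_bigr => i _.
  by congr (_ * _); rewrite coef_poly ltn_ord -fps_mul_trunc.
by rewrite fps_mulC !truncM mulrC mulrA.
Qed.

Fact fps_mul1 : left_id (fpsC 1) fps_mul.
Proof.
move=> f; apply/fpsP => n /=; rewrite big_ord_recl /= mul1r subn0.
by rewrite big1 ?addr0 // => i _; rewrite mul0r.
Qed.

Fact fps_mulDl : left_distributive fps_mul fps_add.
Proof.
move=> f g h; apply/fpsP => n /=; rewrite -big_split.
by apply: eq_bigr => i _; rewrite mulrDl.
Qed.

Fact fps_1neq0 : fpsC 1 != fps_zero.
Proof. by apply/eqP => /fpsP /(_ 0%N) /eqP; rewrite /= oner_eq0. Qed.

HB.instance Definition _ := GRing.Zmodule_isComNzRing.Build (fps R)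
  fps_mulA fps_mulC fps_mul1 fps_mulDl fps_1neq0.

(* The sum of a family of series in which, for every n, only finitely many
   members have a nonzero coefficient of degree n; \sum_(i \in _) is the
   finite-support sum, with junk value 0 when the support is infinite. *)
Definition fps_sum (F : nat -> fps R) : fps R :=
  FPS (fun n => \sum_(i \in [set: nat]) fps_coef (F i) n).

End FpsRing.

Definition catalan (w : seq nat) : bool :=
  (head 0%N w == 0%N) && sorted (fun a b => b <= a.+1)%N w.

Definition avoids_ge_ge (w : seq nat) : bool :=
  ~~ [exists i : 'I_(size w - 2),
       (nth 0 w i >= nth 0 w i.+1)%N && (nth 0 w i.+1 >= nth 0 w i.+2)%N].

(* The cell (i, j) is the unit square [i, i+1] x [j, j+1]. *)
Definition cells (w : seq nat) : seq (nat * nat) :=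
  [seq (i, j) | i <- iota 0 (size w), j <- iota 0 (nth 0%N w i).+1].

(* Edges are given by their endpoints: bottom, top, left, right. *)
Definition cell_edges (c : nat * nat) : seq ((nat * nat) * (nat * nat)) :=
  let: (i, j) := c in
  [:: ((i, j), (i.+1, j)); ((i, j.+1), (i.+1, j.+1));
      ((i, j), (i, j.+1)); ((i.+1, j), (i.+1, j.+1))].

Definition area (w : seq nat) : nat := size (cells w).

(* An unshared edge occurs exactly once among the edges of all cells. *)
Definition perimeter (w : seq nat) : nat :=
  let E := flatten [seq cell_edges c | c <- cells w] in
  count (fun e => count_mem e E == 1%N) E.

Definition sper (w : seq nat) : nat := (perimeter w)./2.

Lemma areaE w : area w = (\sum_(a <- w) a.+1)%N.
Proof.
rewrite /area size_allpairs_dep sumnE big_map.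
under eq_bigr do rewrite size_iota.
by rewrite [RHS](big_nth 0%N) /index_iota subn0.
Qed.

Lemma cell_edges_count e c : let: ((i, j), (i', j')) := e in
  (count_mem e (cell_edges c) <=
   (c == (i, j)) + (c == if i' == i then (i.-1, j) else (i, j.-1)))%N.
Proof.
case: e c => [[i j] [i' j']] [a b] /=; case: (i' =P i) => Ei;
  rewrite !xpair_eqE; repeat case: eqP => //=; lia.
Qed.

Lemma edge_count_le2 w e :
  (count_mem e (flatten [seq cell_edges c | c <- cells w]) <= 2)%N.
Proof.
rewrite count_flatten -map_comp sumnE big_map /=.
have ucells : uniq (cells w).
  apply: allpairs_uniq_dep => [|i _|]; rewrite ?iota_uniq //.
  by move=> [i j] [i' j'] _ _ [-> ->].
case: e (cell_edges_count e) => [[i j] [i' j']] H.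
apply: leq_trans (leq_sum _ (fun c _ => H c)) _.
rewrite big_split /=.
have mem_le1 d : (\sum_(c <- cells w) (c == d) <= 1)%N.
  have -> : (\sum_(c <- cells w) (c == d) = count_mem d (cells w))%N.
    by elim: (cells w) => [|c s IHs]; rewrite ?big_nil // big_cons IHs.
  by rewrite count_uniq_mem ?leq_b1.
exact: leq_add (mem_le1 _) (mem_le1 _).
Qed.

(* The perimeter is even, so the halving in [sper] is exact. *)
Lemma sper_double w : (sper w).*2 = perimeter w.
Proof.
rewrite /sper; suff : ~~ odd (perimeter w) by move=> /negbTE h; rewrite -[RHS]odd_double_half h.
rewrite /perimeter; set E := flatten _.
have cnt2 : (count (fun e => count_mem e E == 1) E
             + count (fun e => count_mem e E == 2) E = size E)%N.
  rewrite -count_predUI -[RHS](count_predT E) [X in (_ + X)%N](eq_count (a2 := pred0)).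
    rewrite count_pred0 addn0; apply: eq_in_count => e eE /=.
    by have := edge_count_le2 w e; rewrite -/E -has_pred1 has_count in eE *;
      case: (count _ _) eE => [|[|[|]]].
  by move=> e /=; case: (count _ _) => [|[|]].
have : ~~ odd (size E).
  rewrite size_flatten /shape -map_comp sumnE big_map.
  apply: (big_ind (fun m => ~~ odd m)) => [//|m n|[i j] _ //].
  by rewrite oddD => /negbTE -> /negbTE ->.
rewrite -cnt2 oddD; suff -> : odd (count (fun e => count_mem e E == 2) E) = false by rewrite addbF.
rewrite -sum1_count -big_undup_iterop_count /=.
apply: (big_ind (fun m => odd m = false)) => [//|m n|e /eqP -> //].
by rewrite oddD => -> ->.
Qed.

(* Letters of a Catalan word are smaller than its length, so words over 'I_n
   account for all Catalan words of length n. *)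
Lemma catalan_letter_lt w a : catalan w -> a \in w -> (a < size w)%N.
Proof.
case: w => // b w /andP[/eqP /= -> ]; set r := (fun _ _ => _) => pw.
suff H m s : path r m s -> forall a, a \in m :: s -> (a <= m + size s)%N.
  by move=> /(H _ _ pw); rewrite add0n ltnS.
elim: s m => [|c s IHs] m /=; first by move=> _ a'; rewrite inE => /eqP->; rewrite addn0.
move=> /andP[rmc /IHs{}IHs] a'; rewrite inE => /predU1P[->|/IHs]; first exact: leq_addr.
by move=> /leq_trans; apply; rewrite addnS -addSn leq_add2r.
Qed.

Definition word (n : nat) (t : n.-tuple 'I_n) : seq nat := [seq val a | a <- t].

Definition catalan_ge_ge (n i : nat) : {set n.-tuple 'I_n} :=
  [set t | [&& catalan (word t), avoids_ge_ge (word t) & last 0%N (word t) == i]].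

Lemma catalan_ge_ge_last n i t :
  (0 < n)%N -> t \in catalan_ge_ge n i -> (i < n)%N.
Proof.
move=> n0; rewrite inE => /and3P[+ _ /eqP <-].
have sw : size (word t) = n by rewrite size_map size_tuple.
move=> /catalan_letter_lt; rewrite sw; apply.
by case: (word t) sw n0 => [<-//|a s] _ _; apply: mem_last.
Qed.

(* Power series in x; p, q, v range over an arbitrary commutative ring, so that
   substituting for v is application. Indeterminates are recovered by taking
   R to be, e.g., the field of fractions of Z[p, q, v]. *)

Section GeneratingFunctions.
Variable R : comNzRingType.
Implicit Types p q v : R.

Definition C_last (i : nat) (p q : R) : fps R :=
  FPS (fun n => if (0 < n)%N then
    \sum_(t in catalan_ge_ge n i) p ^+ sper (word t) * q ^+ area (word t)
  else 0).

Definition C_ge (p q v : R) : fps R :=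
  fps_sum (fun i => C_last i p q * fpsC (v ^+ i)).

End GeneratingFunctions.

(* Main.v *)
(* Split an admissible word of length n >= 3 at its end.  Either the last letter
   is an ascent, necessarily by one, and deleting it leaves an arbitrary
   admissible word; or it is not, and then the letter before it must be an ascent
   from the last letter l of an arbitrary nonempty admissible word, after which
   the final letter i ranges freely over 0, ..., l + 1.  A new column adds 1 to
   the semiperimeter, plus the amount by which it exceeds its neighbour.  Summing
   (q v)^i over i <= l + 1 is a geometric sum, whence the factor 1 / (1 - q v)
   and the two substitutions q and q^2 v. *)

Require Import Defs.
From mathcomp Require Import all_boot all_order all_algebra.
From mathcomp Require Import fsbigop zify ring.

Set Implicit Arguments.
Unset Strict Implicit.
Unset Printing Implicit Defensive.

Import GRing.Theory.

(** * Unshared edges when cells are added one at a time *)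

Definition unshared (T : eqType) (E : seq T) : nat :=
  count (fun e => count_mem e E == 1) E.

Lemma unshared_perm (T : eqType) (E F : seq T) :
  perm_eq E F -> unshared E = unshared F.
Proof.
move=> EF; rewrite /unshared (permP EF); apply: eq_count => e.
by rewrite (permP EF).
Qed.

(** A first copy of [e] is unshared, a second one spoils the first, and later copies change nothing.
    The additive form avoids truncated subtraction. *)
Lemma unshared_cons (T : eqType) (e : T) (E : seq T) :
  unshared (e :: E) + (count_mem e E == 1) = unshared E + (count_mem e E == 0).
Proof.
rewrite /unshared /= eqxx.
have -> : count (fun f => (e == f) + count_mem f E == 1) E =
    count (fun f => (f != e) && (count_mem f E == 1)) E.
  apply: eq_in_count => f fE /=; rewrite [f == e]eq_sym; case: (eqVneq e f) => //= _.
  by move: fE; rewrite -has_pred1 has_count; case: (count _ _).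
have countD1 (a : pred T) s : count a s =
    count (fun f => (f != e) && a f) s + a e * count_mem e s.
  elim: s => [|f s /= ->]; rewrite /= ?muln0 //; case: (eqVneq f e) => [->|_] /=; lia.
rewrite [X in _ = X + _]countD1; case: (count_mem e E) => [|[|n]] /=; lia.
Qed.

Definition edges (cs : seq (nat * nat)) := flatten [seq cell_edges c | c <- cs].

(** An edge borders at most two cells, [a] and [b]. The flag [k] disables [b] for edges on an axis,
    where [.-1] would return a wrong neighbour. *)
Lemma count_edges (cs : seq (nat * nat)) e (a b : nat * nat) (k : bool) :
  uniq cs ->
  (forall c, count_mem e (cell_edges c) = (c == a) + (k && (c == b))) ->
  count_mem e (edges cs) = (a \in cs) + (k && (b \in cs)).
Proof.
move=> ucs eE; rewrite /edges count_flatten -map_comp sumnE big_map /=.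
under eq_bigr do rewrite eE.
have mem_sum d : \sum_(c <- cs) (c == d) = (d \in cs).
  rewrite -count_uniq_mem // -sum1_count [RHS]big_mkcond /=.
  by apply: eq_bigr => c _; case: (c == d).
rewrite big_split /= mem_sum; congr addn.
case: k {eE} => /=; first exact: mem_sum.
by rewrite big1.
Qed.

(* Each edge of the added cell is shared exactly when the neighbour across it is
   present; sharing removes two edges from the unshared ones, the new copy and
   the old one. *)
Lemma unshared_edges_cons (cs : seq (nat * nat)) (i j : nat) :
  uniq cs -> (i, j) \notin cs ->
  unshared (edges ((i, j) :: cs))
    + (((i.+1, j) \in cs) + ((i, j.+1) \in cs)
       + ((0 < i) && ((i.-1, j) \in cs)) + ((0 < j) && ((i, j.-1) \in cs))).*2
  = unshared (edges cs) + 4.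
Proof.
move=> ucs /negbTE ijN.
have ct e a b k := @count_edges cs e a b k ucs.
have e1 : count_mem ((i, j), (i.+1, j)) (edges cs) = ((0 < j) && ((i, j.-1) \in cs)).
  by rewrite (@ct _ (i, j) (i, j.-1) (0 < j)) ?ijN // => -[a b] /=;
    clear; rewrite !xpair_eqE; repeat case: eqP => //=; lia.
have e2 : count_mem ((i, j.+1), (i.+1, j.+1)) (edges cs) = ((i, j.+1) \in cs).
  by rewrite (@ct _ (i, j.+1) (i, j) true) ?ijN ?addn0 // => -[a b] /=;
    clear; rewrite !xpair_eqE; repeat case: eqP => //=; lia.
have e3 : count_mem ((i, j), (i, j.+1)) (edges cs) = ((0 < i) && ((i.-1, j) \in cs)).
  by rewrite (@ct _ (i, j) (i.-1, j) (0 < i)) ?ijN // => -[a b] /=;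
    clear; rewrite !xpair_eqE; repeat case: eqP => //=; lia.
have e4 : count_mem ((i.+1, j), (i.+1, j.+1)) (edges cs) = ((i.+1, j) \in cs).
  by rewrite (@ct _ (i.+1, j) (i, j) true) ?ijN ?addn0 // => -[a b] /=;
    clear; rewrite !xpair_eqE; repeat case: eqP => //=; lia.
have -> : edges ((i, j) :: cs) = [:: ((i, j), (i.+1, j)), ((i, j.+1), (i.+1, j.+1)),
      ((i, j), (i, j.+1)), ((i.+1, j), (i.+1, j.+1)) & edges cs] by [].
set f1 := (_, _) in e1 *; set f2 := (_, _) in e2 *.
set f3 := (_, _) in e3 *; set f4 := (_, _) in e4 *.
have := unshared_cons f1 [:: f2, f3, f4 & edges cs].
have := unshared_cons f2 [:: f3, f4 & edges cs].
have := unshared_cons f3 [:: f4 & edges cs].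
have := unshared_cons f4 (edges cs).
rewrite /= e1 e2 e3 e4.
(* The four edges are pairwise distinct, so inserting one leaves the multiplicities of the others
   unchanged. *)
have -> : (f2 == f1) = false by rewrite /f1 /f2 !xpair_eqE; lia.
have -> : (f3 == f1) = false by rewrite /f1 /f3 !xpair_eqE; lia.
have -> : (f4 == f1) = false by rewrite /f1 /f4 !xpair_eqE; lia.
have -> : (f3 == f2) = false by rewrite /f2 /f3 !xpair_eqE; lia.
have -> : (f4 == f2) = false by rewrite /f2 /f4 !xpair_eqE; lia.
have -> : (f4 == f3) = false by rewrite /f3 /f4 !xpair_eqE; lia.
clear; move: ((i.+1, j) \in cs) ((i, j.+1) \in cs) ((0 < i) && _) ((0 < j) && _).
by do 4 case; rewrite /=; lia.
Qed.

(** * Effect of a new last column on perimeter and area *)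

Lemma mem_cells (w : seq nat) i j :
  ((i, j) \in cells w) = (i < size w) && (j <= nth 0 w i).
Proof.
apply/allpairsPdep/andP => [[a [b []]]|[iw jw]].
  by rewrite !mem_iota !add0n /= => iw jw [-> ->].
by exists i, j; rewrite !mem_iota !add0n /= ltnS.
Qed.

Lemma cells_uniq (w : seq nat) : uniq (cells w).
Proof.
apply: allpairs_uniq_dep => [|i _|]; rewrite ?iota_uniq //.
by move=> [i j] [i' j'] _ _ [-> ->].
Qed.

Lemma cells_rcons (w : seq nat) a :
  cells (rcons w a) = cells w ++ [seq (size w, j) | j <- iota 0 a.+1].
Proof.
rewrite /cells size_rcons -addn1 iotaD map_cat flatten_cat add0n; congr (_ ++ _).
  congr flatten; apply/eq_in_map => i; rewrite mem_iota /= => iw.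
  by rewrite nth_rcons iw.
by rewrite /= cats0 nth_rcons ltnn eqxx.
Qed.

(** Top and bottom of the column add 2; each of its cells above the previous column adds 2 more,
    while a cell touching that column hides as many side edges as it creates. For empty [w] the
    default [last 0 w] would simulate a neighbour of one cell. *)
Lemma perimeter_rcons (w : seq nat) a : 0 < size w ->
  perimeter (rcons w a) = perimeter w + (1 + (a - last 0 w)).*2.
Proof.
move=> w0.
(* Reversal puts the topmost cell first, so that raising [k] is a cons. *)
pose column k := [seq (size w, j) | j <- rev (iota 0 k)].
have mem_column k i j : ((i, j) \in column k) = (i == size w) && (j < k).
  apply/mapP/andP => [[b]|[/eqP -> jk]]; last by exists j; rewrite ?mem_rev ?mem_iota.
  by rewrite mem_rev mem_iota => /= bk [-> ->].
have u_column k : uniq (column k ++ cells w).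
  rewrite cat_uniq cells_uniq andbT map_inj_uniq ?rev_uniq ?iota_uniq => [|? ? [] //].
  apply/hasPn => -[i j]; rewrite mem_cells mem_column; lia.
have last_nth : last 0 w = nth 0 w (size w).-1 by rewrite nth_last.
(* The k-th cell of the new column touches the cell below it (for k > 0) and the
   cell to its left (for k <= last 0 w). *)
have step k : unshared (edges (column k.+1 ++ cells w)) =
    unshared (edges (column k ++ cells w))
      + (if k == 0 then 2 else if k <= last 0 w then 0 else 2).
  have -> : column k.+1 = (size w, k) :: column k.
    by rewrite /column -[k.+1]addn1 iotaD rev_cat /=.
  have := @unshared_edges_cons (column k ++ cells w) (size w) k (u_column k).
  rewrite !mem_cat !mem_cells !mem_column -last_nth; move: (unshared _) (unshared _) => A B.
  by case: (k =P 0) => [->|k0]; [|case: (leqP k (last 0 w))] => *; lia.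
have total k : unshared (edges (column k.+1 ++ cells w)) =
    unshared (edges (cells w)) + (1 + (k - last 0 w)).*2.
  elim: k => [|k IHk]; first by rewrite step.
  by rewrite step IHk /=; case: leqP; lia.
rewrite -[perimeter w]/(unshared (edges (cells w))) -total.
apply: unshared_perm; rewrite /edges cells_rcons.
apply: perm_flatten; apply: perm_map; rewrite perm_catC perm_cat2r.
by apply: perm_map; rewrite perm_sym perm_rev.
Qed.

Lemma sper_rcons (w : seq nat) a : 0 < size w ->
  sper (rcons w a) = sper w + 1 + (a - last 0 w).
Proof.
move=> w0; apply: double_inj.
by rewrite sper_double perimeter_rcons // !doubleD sper_double; lia.
Qed.

Lemma area_rcons (w : seq nat) a : area (rcons w a) = area w + a.+1.
Proof. by rewrite !areaE big_rcons. Qed.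

(** * Admissibility under a new last letter *)

Lemma catalan_rcons (w : seq nat) a : 0 < size w ->
  catalan (rcons w a) = catalan w && (a <= (last 0 w).+1).
Proof. by case: w => // b w _; rewrite /catalan /= rcons_path andbA. Qed.

Lemma avoids_ge_geP (w : seq nat) :
  reflect (forall i, i.+2 < size w ->
             ~~ (nth 0 w i.+1 <= nth 0 w i) || ~~ (nth 0 w i.+2 <= nth 0 w i.+1))
          (avoids_ge_ge w).
Proof.
rewrite /avoids_ge_ge; apply: (iffP existsPn) => H i.
  move=> iw; have iw' : i < size w - 2 by lia.
  by have := H (Ordinal iw'); rewrite negb_and.
by rewrite negb_and; apply: H; have := ltn_ord i; lia.
Qed.

(** The only new window of three consecutive letters is [last 0 w], [b], [a]. *)
Lemma avoids_ge_ge_rcons (w : seq nat) b a : 0 < size w ->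
  avoids_ge_ge (rcons (rcons w b) a) =
    avoids_ge_ge (rcons w b) && ((last 0 w < b) || (b < a)).
Proof.
move=> w0; have szb : size (rcons w b) = (size w).+1 by rewrite size_rcons.
have nth_old i : i <= size w -> nth 0 (rcons (rcons w b) a) i = nth 0 (rcons w b) i.
  by move=> iw; rewrite [LHS]nth_rcons szb ltnS iw.
have nth_b : nth 0 (rcons w b) (size w) = b by rewrite nth_rcons ltnn eqxx.
have nth_a : nth 0 (rcons (rcons w b) a) (size w).+1 = a.
  by rewrite nth_rcons szb ltnn eqxx.
have nth_l : nth 0 (rcons w b) (size w).-1 = last 0 w.
  by rewrite nth_rcons prednK // leqnn nth_last.
apply/avoids_ge_geP/andP => [H|[/avoids_ge_geP H lba] i].
  split; last first.
    have := H (size w).-1; rewrite !size_rcons prednK // => /(_ (ltnSn _)).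
    by rewrite nth_a !nth_old ?leq_pred // nth_b nth_l -!ltnNge.
  apply/avoids_ge_geP => i; rewrite szb => iw.
  by have := H i; rewrite !size_rcons !nth_old; try lia; apply; lia.
rewrite size_rcons szb !ltnS leq_eqVlt => /orP[/eqP iw|iw]; last first.
  by rewrite !nth_old; try lia; apply: H; rewrite szb; lia.
move: lba nth_a nth_b nth_l; rewrite -iw /= => lba -> nth_b nth_l.
by rewrite !nth_old -?iw // nth_b nth_l -!ltnNge.
Qed.

(** A forbidden triple ends in a weak descent, so an ascent cannot complete one. *)
Lemma avoids_ge_ge_rcons_ascent (w : seq nat) b : last 0 w < b ->
  avoids_ge_ge (rcons w b) = avoids_ge_ge w.
Proof.
case/lastP: w => [|w c].
  by move=> _; rewrite /avoids_ge_ge; congr negb; apply/existsP/existsP => -[[]].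
rewrite last_rcons => cb; case: (posnP (size w)) => [/size0nil ->|w0].
  by apply/avoids_ge_geP/avoids_ge_geP.
by rewrite avoids_ge_ge_rcons // cb orbT andbT.
Qed.

(** * Enumeration of admissible words by length *)

Definition avoiding_words n : seq (seq nat) :=
  [seq word t | t in [set t : n.-tuple 'I_n |
                       catalan (word t) && avoids_ge_ge (word t)]].

Lemma word_inj n : injective (@word n).
Proof. by move=> t u /(inj_map val_inj) /val_inj. Qed.

Lemma avoiding_words_uniq n : uniq (avoiding_words n).
Proof. by rewrite map_inj_uniq ?enum_uniq //; apply: word_inj. Qed.

Lemma mem_avoiding_words n (w : seq nat) :
  (w \in avoiding_words n) = [&& size w == n, catalan w & avoids_ge_ge w].
Proof.
apply/imageP/and3P => [[t]|[/eqP sw cw aw]].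
  by rewrite inE => /andP[? ?] ->; rewrite size_map size_tuple.
have wn a : a \in w -> a < n by move=> /(catalan_letter_lt cw); rewrite sw.
have [s ws] : {s : seq 'I_n | w = [seq val a | a <- s]}.
  exists (pmap insub w); rewrite pmap_filter; last exact: insubK.
  apply/esym/all_filterP/allP => a /wn an.
  by rewrite insubT.
have ss : size s == n by apply/eqP; rewrite -[RHS]sw ws size_map.
by exists (Tuple ss); rewrite ?inE /word /= -ws ?cw.
Qed.

Lemma avoiding_words1 : perm_eq (avoiding_words 1) [:: [:: 0]].
Proof.
apply: uniq_perm => [||w]; rewrite ?avoiding_words_uniq //.
rewrite mem_avoiding_words inE; apply/and3P/eqP => [[]|->].
  by case: w => [|a []] // _ /andP[/eqP /= ->].
by split=> //; apply/avoids_ge_geP.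
Qed.

Lemma avoiding_words2 : perm_eq (avoiding_words 2) [:: [:: 0; 1]; [:: 0; 0]].
Proof.
apply: uniq_perm => [||w]; rewrite ?avoiding_words_uniq //.
rewrite mem_avoiding_words !inE; apply/and3P/orP => [[]|[]/eqP ->].
- case: w => [|a [|b []]] // _ /andP[/eqP /= ->]; rewrite andbT => b1 _.
  by case: b b1 => [|[|]] //; [right|left].
- by split=> //; apply/avoids_ge_geP.
- by split=> //; apply/avoids_ge_geP.
Qed.

(** Length 3 is the least for which removing two letters still leaves a nonempty word. *)
Lemma avoiding_wordsSSS n :
  perm_eq (avoiding_words n.+3)
    ([seq rcons w (last 0 w).+1 | w <- avoiding_words n.+2] ++
     [seq rcons (rcons w (last 0 w).+1) i
        | w <- avoiding_words n.+1, i <- iota 0 (last 0 w).+2]).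
Proof.
apply: uniq_perm; first exact: avoiding_words_uniq.
  rewrite cat_uniq map_inj_in_uniq ?avoiding_words_uniq ?andTb; last first.
    by move=> w w' _ _ /rcons_inj[].
  apply/andP; split.
    (* The two lists are disjoint: words of the first end in an ascent, those of the second in a
       weak descent. *)
    apply/hasPn => z /allpairsPdep[w [i [_]]]; rewrite mem_iota => /= iw ->.
    apply/mapP => -[w' _ /rcons_inj[<-]]; rewrite last_rcons; lia.
  apply: allpairs_uniq_dep => [|w _|]; rewrite ?avoiding_words_uniq ?iota_uniq //.
  by move=> [w i] [w' i'] _ _ /= /rcons_inj[/rcons_inj[-> _] ->].
move=> w; rewrite mem_avoiding_words mem_cat.
apply/and3P/orP => [[]|[/mapP[u]|/allpairsPdep[u [a [+ +]]]]].
- case/lastP: w => // w a; case/lastP: w => // w b.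
  rewrite !size_rcons !eqSS => /eqP sw; have w0 : 0 < size w by rewrite sw.
  rewrite catalan_rcons ?size_rcons // last_rcons => /andP[cwb ab].
  rewrite avoids_ge_ge_rcons // => /andP[awb lba].
  case: (eqVneq a b.+1) => [->|ab1]; [left|right].
    apply/mapP; exists (rcons w b); rewrite ?last_rcons //.
    by rewrite mem_avoiding_words size_rcons sw eqxx cwb.
  move: cwb; rewrite catalan_rcons // => /andP[cw bw].
  (* Here [a <= b], so avoidance forces [last 0 w < b], and the Catalan bound leaves one value. *)
  have -> : b = (last 0 w).+1 by lia.
  apply/allpairsPdep; exists w, a; rewrite mem_iota mem_avoiding_words sw eqxx cw.
  split=> //; last lia.
  by rewrite -(@avoids_ge_ge_rcons_ascent w b) //; lia.
- rewrite mem_avoiding_words => /and3P[/eqP su cu au] ->.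
  rewrite size_rcons su catalan_rcons ?su // cu leqnn; split=> //.
  by rewrite avoids_ge_ge_rcons_ascent.
- rewrite mem_avoiding_words => /and3P[/eqP su cu au].
  rewrite mem_iota add0n => /= au2 ->.
  rewrite !size_rcons su !catalan_rcons ?size_rcons ?su // cu leqnn last_rcons.
  split; [by [] | exact: ltnW | rewrite avoids_ge_ge_rcons ?su // ltnSn andbT].
  by rewrite avoids_ge_ge_rcons_ascent.
Qed.

Local Open Scope ring_scope.

(** * Coefficients of the series and weights of words *)

Lemma coef_fpsCM (R : comNzRingType) (c : R) (f : fps R) n :
  fps_coef (fpsC c * f) n = c * fps_coef f n.
Proof.
rewrite [LHS]big_ord_recl /= subn0 big1 ?addr0 // => i _.
by rewrite mul0r.
Qed.

Lemma coef_fpsXM (R : comNzRingType) (f : fps R) n :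
  fps_coef (fpsX R * f) n = if n is m.+1 then fps_coef f m else 0.
Proof.
case: n => [|n]; first by rewrite [LHS]big_ord1 /= mul0r.
rewrite [LHS]big_ord_recl [X in _ + X]big_ord_recl /= mul0r mul1r add0r subSS subn0.
by rewrite big1 ?addr0 // => i _; rewrite mul0r.
Qed.

Definition word_weight (R : comNzRingType) (p q v : R) (w : seq nat) : R :=
  p ^+ sper w * q ^+ area w * v ^+ last 0%N w.

(** Last letters are below [n], so the sum over [i] has finite support; each word then occurs for
    exactly one [i]. *)
Lemma coef_C_ge (R : comNzRingType) (p q v : R) n :
  fps_coef (C_ge p q v) n =
  if n is 0 then 0 else \sum_(w <- avoiding_words n) word_weight p q v w.
Proof.
have coefE i : fps_coef (C_last i p q * fpsC (v ^+ i)) n =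
    v ^+ i * fps_coef (C_last i p q) n by rewrite mulrC coef_fpsCM.
rewrite [LHS](eq_fsbigr _ _ (in1W coefE)).
case: n {coefE} => [|n]; first by rewrite fsbig1 // => i _; rewrite mulr0.
rewrite (fsbigE (iota 0 n.+1)) ?iota_uniq //; last first.
  move=> i _; rewrite mem_iota /= add0n -leqNgt => ni.
  rewrite /= big1 ?mulr0 // => t.
  by move=> /(catalan_ge_ge_last (ltn0Sn n)); lia.
rewrite (eq_bigl xpredT) => [|i]; last exact: classical_sets.in_setT.
rewrite /avoiding_words big_image.
(* The last-letter condition moves into the summand, which frees the index set from [i] and allows
   exchanging the sums. *)
transitivity (\sum_(i <- iota 0 n.+1)
    \sum_(t : n.+1.-tuple 'I_n.+1 | catalan (word t) && avoids_ge_ge (word t))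
      if last 0%N (word t) == i then word_weight p q v (word t) else 0).
  apply: eq_bigr => i _; rewrite [fps_coef _ _]/= mulr_sumr -big_mkcondr /=.
  apply: eq_big => [t|t]; first by rewrite inE andbA.
  rewrite inE => /and3P[_ _ /eqP <-].
  by rewrite mulrC.
rewrite exchange_big; apply: eq_big => [t|t ct]; first by rewrite inE.
have lt_last : (last 0 (word t) < n.+1)%N.
  by apply: (@catalan_ge_ge_last n.+1 _ t) => //; rewrite inE andbA ct eqxx.
rewrite (bigD1_seq (last 0%N (word t))) ?mem_iota ?iota_uniq //= eqxx.
by rewrite big1 ?addr0 // => i /negbTE; rewrite eq_sym => ->.
Qed.

Lemma word_weight_rcons (R : comNzRingType) (p q v : R) (w : seq nat) a :
  (0 < size w)%N ->
  word_weight p q v (rcons w a) =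
  p ^+ (sper w + 1 + (a - last 0%N w)) * q ^+ (area w + a.+1) * v ^+ a.
Proof. by move=> w0; rewrite /word_weight sper_rcons // area_rcons last_rcons. Qed.

Lemma word_weight_ascent (R : comNzRingType) (p q v : R) (w : seq nat) :
  (0 < size w)%N ->
  word_weight p q v (rcons w (last 0%N w).+1) =
  p ^+ 2 * q ^+ 2 * v * word_weight p q (q * v) w.
Proof.
move=> w0; rewrite word_weight_rcons // subSnn /word_weight exprMn.
rewrite !exprD !exprS expr0; ring.
Qed.

(** With [l] the last letter of [w], the two columns contribute
    [p ^+ 3 * q ^+ (l + 3) * (q * v) ^+ i]. In the geometric sum, 1 leaves [q ^+ l], and
    [(q * v) ^+ l.+2] leaves [q ^+ 2 * v ^+ 2 * (q ^+ 2 * v) ^+ l]. *)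
Lemma word_weight_ascent_descents (R : comUnitRingType) (p q v : R) (w : seq nat) :
  1 - q * v \is a GRing.unit -> (0 < size w)%N ->
  \sum_(i <- iota 0 (last 0%N w).+2)
    word_weight p q v (rcons (rcons w (last 0%N w).+1) i) =
  p ^+ 3 * q ^+ 3 / (1 - q * v) * word_weight p q q w
  - p ^+ 3 * q ^+ 5 * v ^+ 2 / (1 - q * v) * word_weight p q (q ^+ 2 * v) w.
Proof.
move=> uqv w0; set l := last 0%N w.
have -> : \sum_(i <- iota 0 l.+2) word_weight p q v (rcons (rcons w l.+1) i) =
    p ^+ 3 * q ^+ 3 * word_weight p q q w * \sum_(i < l.+2) (q * v) ^+ i.
  rewrite -[iota 0 l.+2]/(index_iota 0 l.+2) big_mkord mulr_sumr.
  apply: eq_bigr => i _.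
  rewrite word_weight_rcons ?size_rcons // last_rcons sper_rcons // area_rcons.
  (* The final column never rises above its neighbour. *)
  have -> : (i - l.+1 = 0)%N by have := ltn_ord i; lia.
  rewrite -/l subSnn addn0 /word_weight -/l exprMn !exprD !exprS expr0; ring.
have geo : \sum_(i < l.+2) (q * v) ^+ i = (1 - (q * v) ^+ l.+2) / (1 - q * v).
  by apply: canRL (mulrK uqv) _; rewrite -[RHS]opprB subrX1; ring.
rewrite geo /word_weight -/l !exprMn !exprS; ring.
Qed.

Theorem theorem2p1 (R : comUnitRingType) (p q v : R)
    (h1qv : 1 - q * v \is a GRing.unit) :
  let x := fpsX R in
  C_ge p q v =
    fpsC (p ^+ 2 * q) * x + fpsC (p ^+ 3 * q ^+ 2) * x ^+ 2
    + fpsC (p ^+ 3 * q ^+ 3 / (1 - q * v)) * x ^+ 2 * C_ge p q q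
    + fpsC (p ^+ 2 * q ^+ 2 * v) * x * C_ge p q (q * v)
    - fpsC (p ^+ 3 * q ^+ 5 * v ^+ 2 / (1 - q * v)) * x ^+ 2
      * C_ge p q (q ^+ 2 * v).
Proof.
move=> x; apply/fpsP => n.
have coefD (f g : fps R) : fps_coef (f + g) n = fps_coef f n + fps_coef g n by [].
have coefB (f g : fps R) : fps_coef (f - g) n = fps_coef f n - fps_coef g n by [].
rewrite coefB !coefD -!mulrA !coef_fpsCM expr2 -!mulrA.
have coef_x m : fps_coef x m = (m == 1%N)%:R by [].
have sper1 : sper [:: 0%N] = 2 by [].
have area1 : area [:: 0%N] = 1%N by [].
have weight1 u : word_weight p q u [:: 0%N] = p ^+ 2 * q.
  by rewrite /word_weight sper1 area1 expr0 expr1 mulr1.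
(* Lengths below 3 are checked directly: the words 0 and 00 give the two terms free of [C_ge], and
   01 is an ascent from 0. *)
rewrite !coef_fpsXM coef_x; case: n {coefD coefB} => [|[|[|n]]].
- by rewrite coef_C_ge /=; ring.
- rewrite !coef_fpsXM coef_x !coef_C_ge (perm_big _ avoiding_words1) big_seq1 weight1 /=.
  ring.
- rewrite !coef_fpsXM coef_x !coef_C_ge (perm_big _ avoiding_words2).
  rewrite (perm_big _ avoiding_words1) !big_cons !big_nil.
  rewrite -[[:: 0; 1]]/(rcons [:: 0] (last 0 [:: 0]).+1)%N word_weight_ascent //.
  rewrite -[[:: 0; 0]]/(rcons [:: 0] 0)%N word_weight_rcons // sper1 area1 weight1 /=.
  ring.
- rewrite !coef_fpsXM coef_x !coef_C_ge (perm_big _ (avoiding_wordsSSS n)) big_cat.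
  have nonempty m w : w \in avoiding_words m.+1 -> (0 < size w)%N.
    by rewrite mem_avoiding_words => /and3P[/eqP ->].
  rewrite big_map big_allpairs_dep.
  (* Final ascents give the [q * v] term; the other words give both terms over [1 - q * v]. *)
  under eq_big_seq => w /nonempty w0 do rewrite word_weight_ascent //.
  under [X in _ + X = _]eq_big_seq => w /nonempty w0
    do rewrite word_weight_ascent_descents //.
  rewrite sumrB -!mulr_sumr /= (mulrA q q v) -expr2; ring.
Qed.
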